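(* Let $F$ be an algebraically closed field, $m\ge 1$ an integer, $V=\mathrm{Mat}(m\times m^2;F)$, and let $P$ and $V_0\subseteq V$ be the map and the subset defined in the context (constructed from any admissible choice of an integer $k\ge 2$, of $m^k$ contractions and of $m$ columns). Then two $m$-dimensional algebras over $F$ with matrices of structural constants $A,B\in V_0$ are isomorphic if and only if $$P(A)\,A\,\bigl(P(A)^{-1}\otimes P(A)^{-1}\bigr)=P(B)\,B\,\bigl(P(B)^{-1}\otimes P(B)^{-1}\bigr).$$
   Context: An $m$-dimensional algebra over $F$ is an $m$-dimensional $F$-vector space $W$ with a bilinear multiplication $W\times W\to W$ (no further axioms). Given a basis $e=(e^1,\dots,e^m)$ of $W$, its matrix of structural constants is the matrix $A=(A^i_{j,l})\in \mathrm{Mat}(m\times m^2;F)$ (rows indexed by $i$, columns by pairs $(j,l)$ in lexicographic order) with $\mathbf u\cdot\mathbf v=eA(u\otimes v)$ for $\mathbf u=eu$, $\mathbf v=ev$, where $u,v$ are column vectors and $\otimes$ is the Kronecker product. The group $G=GL(m,F)$ acts on $V$ by $\tau(g,A)=gA(g^{-1}\otimes g^{-1})$; two algebras with matrices $A,B$ are isomorphic iff $B=\tau(g,A)$ for some $g\in G$. Construction of $P$ and $V_0$. Let $X=(X^i_{j,l})$ be an $m\times m^2$ matrix of algebraically independent variables over $F$. For an integer $k\ge1$, the tensor power $X^{\otimes k}$ has $k$ upper and $2k$ lower indices. A contraction of $X^{\otimes k}$ is the row vector of length $m^k$ obtained by contracting (setting equal and summing from $1$ to $m$) each of the $k$ upper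 indices with one of the $2k$ lower indices, different upper indices being contracted with different lower indices; the remaining $k$ lower indices, taken in their natural order, index the $m^k$ entries in lexicographic order. Each contraction $f$ satisfies $f(\tau(g,A))=f(A)(g^{-1})^{\otimes k}$. For $k=1$, one of the contractions is $\mathbf{Tr}_1(X)$, the row vector of length $m$ with $i$-th entry $\sum_{j=1}^m X^j_{j,i}$. Choose $k\ge 2$ and $m^k$ contractions of $X^{\otimes k}$ such that the $m^k\times m^k$ matrix $Q(X)$ having these contractions as rows is nonsingular (that is, $\det Q(X)$ is not the zero polynomial). Consider the $m\times m^k$ matrix $M(X)=\bigl(X\otimes \mathbf{Tr}_1(X)^{\otimes (k-2)}\bigr)Q(X)^{-1}$ over $F(X)$, and choose $m$ of its columns such that the $m\times m$ submatrix formed by them is nonsingular over $F(X)$. Denote this submatrix by $P(X)^{-1}$, and its inverse by $P(X)$. Let $V_0$ be the set of all $A\in V$ such that $\det Q(A)\ne 0$ and the matrix $P(A)^{-1}$ (the chosen submatrix of $M(A)$) is nonsingular; for $A\in V_0$, $P(A)\in GL(m,F)$ is its inverse. *)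

(* Defs.v *)
From HB Require Import structures.
From mathcomp Require Import all_boot all_order all_algebra.
From mathcomp Require Export fraction sesquilinear mxtens.
From mathcomp Require Export mpoly.

Set Implicit Arguments.
Unset Strict Implicit.
Unset Printing Implicit Defensive.

Import GRing.Theory.
Local Open Scope ring_scope.

Section Algebras.

Variables (F : fieldType) (m : nat).

Definition lincomb (W : lmodType F) (e : m.-tuple W) (u : 'cV[F]_m) : W :=
  \sum_(i < m) u i 0 *: tnth e i.

(* [mxtens_index (j, l)] has value [j * m + l], so the columns of [A] are the
   pairs (j, l) in lexicographic order and [*t] is the Kronecker product. *)
Definition structure_constants (W : lmodType F) (mul : W -> W -> W)
    (e : m.-tuple W) (A : 'M[F]_(m, m * m)) : Prop :=
  forall u v : 'cV[F]_m,
    mul (lincomb e u) (lincomb e v) = lincomb e (A *m (u *t v)).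

Definition algebra_isomorphic (W1 W2 : lmodType F)
    (mul1 : W1 -> W1 -> W1) (mul2 : W2 -> W2 -> W2) : Prop :=
  exists f : {linear W1 -> W2},
    bijective f /\ forall x y, f (mul1 x y) = mul2 (f x) (f y).

End Algebras.

(* Lexicographic rank of a word over {0, ..., m-1} (words of equal length). *)
Definition lex_rank (m : nat) (s : seq nat) : nat :=
  foldl (fun acc d => acc * m + d)%N 0%N s.

(* The 2k lower indices of X^{(x)k} are numbered by 'I_(k * 2): the a-th factor
   X^{i_a}_{j_a, l_a} carries the positions [lower1 a] = 2a and
   [lower2 a] = 2a + 1. *)
Definition lower1 (k : nat) (a : 'I_k) : 'I_(k * 2) :=
  mxtens_index (a, ord0 : 'I_2).
Definition lower2 (k : nat) (a : 'I_k) : 'I_(k * 2) :=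
  mxtens_index (a, ord_max : 'I_2).

(* [s a] is the lower index with which the a-th upper index is contracted, so
   [s] must be injective. The entry at [q] sums over all values [l] of the 2k
   lower indices for which the uncontracted ones ([enum] lists them in
   increasing order) form the multi-index of lexicographic rank [q]. *)
Definition contraction (R : pzSemiRingType) (m k : nat)
    (s : 'I_k -> 'I_(k * 2)) (X : 'M[R]_(m, m * m)) : 'rV[R]_(m ^ k) :=
  \row_q \sum_(l : {ffun 'I_(k * 2) -> 'I_m} |
               lex_rank m [seq nat_of_ord (l p) |
                            p <- enum [predC codom s]] == q)
         \prod_(a < k) X (l (s a)) (mxtens_index (l (lower1 a), l (lower2 a))).

Definition Tr1 (R : pzSemiRingType) (m : nat) (X : 'M[R]_(m, m * m)) :
    'rV[R]_m :=
  \row_i \sum_(j < m) X j (mxtens_index (j, i)).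

Definition Qmx (R : pzSemiRingType) (m k : nat)
    (c : 'I_(m ^ k) -> 'I_k -> 'I_(k * 2)) (X : 'M[R]_(m, m * m)) :
    'M[R]_(m ^ k) :=
  \matrix_(r < m ^ k) contraction (c r) X.

Lemma Mmx_rows (m k : nat) : (m * 1 ^ (k - 2) = m)%N.
Proof. by rewrite exp1n muln1. Qed.

Lemma Mmx_cols (m k : nat) : (2 <= k)%N -> (m * m * m ^ (k - 2) = m ^ k)%N.
Proof. by move=> hk; rewrite mulnn -expnD subnKC. Qed.

Definition Mmx (K : fieldType) (m k : nat) (hk : (2 <= k)%N)
    (c : 'I_(m ^ k) -> 'I_k -> 'I_(k * 2)) (X : 'M[K]_(m, m * m)) :
    'M[K]_(m, m ^ k) :=
  castmx (Mmx_rows m k, Mmx_cols m hk) (X *t (Tr1 X ^t (k - 2)))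
    *m invmx (Qmx c X).

(* The submatrix of [Mmx] formed by the columns [h 0], ..., [h (m-1)], i.e.
   the matrix whose inverse is [Pmx]. *)
Definition Psub (K : fieldType) (m k : nat) (hk : (2 <= k)%N)
    (c : 'I_(m ^ k) -> 'I_k -> 'I_(k * 2)) (h : 'I_m -> 'I_(m ^ k))
    (X : 'M[K]_(m, m * m)) : 'M[K]_m :=
  colsub h (Mmx hk c X).

Definition Pmx (K : fieldType) (m k : nat) (hk : (2 <= k)%N)
    (c : 'I_(m ^ k) -> 'I_k -> 'I_(k * 2)) (h : 'I_m -> 'I_(m ^ k))
    (X : 'M[K]_(m, m * m)) : 'M[K]_m :=
  invmx (Psub hk c h X).

(* [invmx] is the identity on singular matrices, so both conditions are
   needed for [Pmx] to be meaningful at [A]. *)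
Definition V0 (F : fieldType) (m k : nat) (hk : (2 <= k)%N)
    (c : 'I_(m ^ k) -> 'I_k -> 'I_(k * 2)) (h : 'I_m -> 'I_(m ^ k)) :
    pred 'M[F]_(m, m * m) :=
  [pred A | (\det (Qmx c A) != 0) && (Psub hk c h A \in unitmx)].

Definition genericX (F : fieldType) (m : nat) :
    'M[{mpoly F[m * (m * m)]}]_(m, m * m) :=
  \matrix_(i, jl) 'X_(mxtens_index (i, jl)).

Definition genericXF (F : fieldType) (m : nat) :
    'M[{fraction {mpoly F[m * (m * m)]}}]_(m, m * m) :=
  map_mx (@tofrac _) (genericX F m).

(* A choice of k, contractions and columns as in the construction of P. *)
Definition admissible (F : fieldType) (m k : nat) (hk : (2 <= k)%N)
    (c : 'I_(m ^ k) -> 'I_k -> 'I_(k * 2)) (h : 'I_m -> 'I_(m ^ k)) : Prop :=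
  [/\ forall r, injective (c r),
      \det (Qmx c (genericX F m)) != 0 &
      Psub hk c h (genericXF F m) \in unitmx].

(* Main.v *)
From HB Require Import structures.
Require Import Defs.
From mathcomp Require Import all_boot all_order all_algebra.

Set Implicit Arguments.
Unset Strict Implicit.
Unset Printing Implicit Defensive.

Import GRing.Theory.
Local Open Scope ring_scope.

(** Two algebras are isomorphic exactly when their structure matrices lie in the
same orbit of [tau g A = g A (g^-1 (x) g^-1)]
([algebra_isomorphic_iff_same_orbit]), so the theorem says that
[A |-> tau (P A) A] separates the orbits met by [V0].

The reason is that [P] is a moving frame: [P (tau g A) = P A g^-1]. Granted
this, [tau (P (tau g A)) (tau g A) = tau (P A g^-1 g) A = tau (P A) A], so the
expression is constant on orbits; conversely, if [tau (P A) A = tau (P B) B],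
then [B = tau ((P B)^-1 (P A)) A], so [A] and [B] share an orbit. This is
[same_orbit_iff_eq_canonical_form].

The frame property comes from invariant theory. A contraction pairs every upper
index with a lower one; there the factors [g] and [g^-1] cancel, and each of the
[k] remaining lower indices keeps one factor [g^-1]. Hence
[f (tau g A) = f A (g^-1)^(x)k] for each contraction [f]
([contraction_equivariant]), and so [Q (tau g A) = Q A (g^-1)^(x)k]. The matrix
[X (x) Tr1 X^(x)(k-2)] also has [k] free lower indices, and one upper index
besides, so it is multiplied by the same [(g^-1)^(x)k] on the right and by [g]
on the left. In the quotient [M] the right factors cancel, leaving
[M (tau g A) = g M A] ([Mmx_tau]). Selecting columns commutes with left
multiplication, so the chosen square submatrix [P^-1] is multiplied by [g] on
the left too.

The equivariance of contractions is a computation with sums over the values of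
all [2k] lower indices. Multiplying out [g X (h (x) h)] in each of the [k]
factors ([tensor_entry_mull], [tensor_entry_mulr]) leaves, for fixed values of
the free indices, a sum over the contracted ones that factors index by index
([sum_free_word]); each factor is an entry of [h g = 1]. *)

(** * Words and multi-indices *)

Lemma lex_rank_cons m x s :
  lex_rank m (x :: s) = (x * m ^ size s + lex_rank m s)%N.
Proof.
have foldE: forall s a, foldl (fun acc d => acc * m + d)%N a s
    = (a * m ^ size s + lex_rank m s)%N.
  elim=> [|y s' IH] a /=; first by rewrite muln1 addn0.
  by rewrite IH [lex_rank m (y :: s')]IH /= mul0n add0n mulnDl -mulnA -expnS
    addnA.
by rewrite /lex_rank /= mul0n add0n foldE.
Qed.

Lemma lex_rank_lt m k (w : k.-tuple 'I_m) :
  (lex_rank m [seq nat_of_ord i | i <- w] < m ^ k)%N.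
Proof.
elim: k w => [|k IH] w; first by rewrite tuple0.
case/tupleP: w => x w /=; rewrite lex_rank_cons size_map size_tuple expnS.
apply: (@leq_trans (x * m ^ k + m ^ k)%N); first by rewrite ltn_add2l.
by rewrite addnC -mulSn leq_mul2r ltn_ord orbT.
Qed.

(** Words of length [k] are the multi-indices of a [k]-fold Kronecker power;
this turns one into the row or column number that it has there. *)
Definition word_index m k (w : k.-tuple 'I_m) : 'I_(m ^ k) :=
  Ordinal (lex_rank_lt w).

Lemma word_index_bij m k : bijective (@word_index m k).
Proof.
apply: inj_card_bij; last by rewrite card_tuple !card_ord.
move=> w v /(congr1 val) /=.
elim: k w v => [|k IH] w v; first by rewrite [w]tuple0 [v]tuple0.
case/tupleP: w => x w; case/tupleP: v => y v.
have rank_consE (z : 'I_m) (u : k.-tuple 'I_m) :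
    lex_rank m [seq nat_of_ord i | i <- z :: u]
    = (z * m ^ k + lex_rank m [seq nat_of_ord i | i <- u])%N.
  by rewrite /= lex_rank_cons size_map size_tuple.
rewrite !rank_consE => /eqP.
by rewrite eq_addl_mul ?lex_rank_lt // => /eqP [/val_inj -> /IH ->].
Qed.

(** * Kronecker powers *)

Section Kronecker.

Variable R : comNzRingType.

Lemma tensmx11 m n : 1%:M *t 1%:M = 1%:M :> 'M[R]_(m * n).
Proof.
apply/matrixP=> i j.
case: (mxtens_indexP i) => a b; case: (mxtens_indexP j) => c d.
rewrite tensmxE !mxE (can_eq (@mxtens_indexK m n)) xpair_eqE.
by rewrite -natrM mulnb.
Qed.

Lemma ntensmx0E m n (A : 'M[R]_(m, n)) (i : 'I_(m ^ 0)) (j : 'I_(n ^ 0)) :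
  (A ^t 0) i j = 1.
Proof. by rewrite ntensmx0 mxE [i]ord1 [j]ord1. Qed.

(** Gives a uniform recursion from exponent [k] to [k.+1], whereas [A ^t 1] is
[A] itself rather than [A *t 1]. *)
Lemma ntensmx_cons m n (A : 'M[R]_(m, n)) k x y
    (w : k.-tuple 'I_m) (v : k.-tuple 'I_n) :
  (A ^t k.+1) (word_index [tuple of x :: w]) (word_index [tuple of y :: v])
  = A x y * (A ^t k) (word_index w) (word_index v).
Proof.
case: k w v => [|k] w v.
  have -> : (A ^t 0) (word_index w) (word_index v) = 1 by apply: ntensmx0E.
  rewrite ntensmx1 mulr1 [w]tuple0 [v]tuple0.
  by congr (A _ _); apply: val_inj; rewrite /= lex_rank_cons muln1 addn0.
rewrite ntensmxSS -tensmxE; congr ((_ *t _) _ _); apply: val_inj => /=;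
  by rewrite lex_rank_cons size_map size_tuple.
Qed.

Lemma ntensmxE m n (A : 'M[R]_(m, n)) k
    (w : k.-tuple 'I_m) (v : k.-tuple 'I_n) :
  (A ^t k) (word_index w) (word_index v)
  = \prod_(a < k) A (tnth w a) (tnth v a).
Proof.
elim: k w v => [|k IH] w v; first by rewrite big_ord0 ntensmx0E.
case/tupleP: w => x w; case/tupleP: v => y v.
rewrite ntensmx_cons IH big_ord_recl !tnth0; congr (_ * _).
by apply: eq_bigr => a _; rewrite !tnthS.
Qed.

Lemma ntensmx_mul m n p (A : 'M[R]_(m, n)) (B : 'M[R]_(n, p)) k :
  A ^t k *m B ^t k = (A *m B) ^t k.
Proof.
case: k => [|k]; first by rewrite !ntensmx0 mulmx1.
elim: k => [|k IH]; first by rewrite !ntensmx1.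
by rewrite !ntensmxSS tensmx_mul IH.
Qed.

Lemma ntensmx_id m k : 1%:M ^t k = 1%:M :> 'M[R]_(m ^ k).
Proof.
case: k => [|k] //; elim: k => [|k IH]; first by rewrite ntensmx1.
by rewrite ntensmxSS IH tensmx11.
Qed.

(** Associativity of the Kronecker product, in the bracketing that arises from
the numerator of [Mmx]: both sides have the same entries at words. *)
Lemma castmx_ntensmx m j k (A : 'M[R]_m) (ek : k = j.+2)
    (e : (m * m * m ^ j = m ^ k)%N) :
  castmx (e, e) (A *t A *t A ^t j) = A ^t k.
Proof.
subst k.
have [d idxK idxK'] := word_index_bij m j.+2.
apply/matrixP=> p q; rewrite -(idxK' p) -(idxK' q) castmxE /=.
have wordE (w : j.+2.-tuple 'I_m) : exists x y (v : j.-tuple 'I_m),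
    w = [tuple of x :: [tuple of y :: v]].
  by case/tupleP: w => x w; case/tupleP: w => y v; exists x, y, v.
have castE x y (v : j.-tuple 'I_m) :
    cast_ord (esym e) (word_index [tuple of x :: [tuple of y :: v]])
    = mxtens_index (mxtens_index (x, y), word_index v).
  apply: val_inj; rewrite /= !lex_rank_cons /= size_map size_tuple.
  by rewrite mulnDl addnA expnS mulnA.
have [x [y [v ->]]] := wordE (d p); have [x' [y' [v' ->]]] := wordE (d q).
by rewrite !castE !tensmxE !ntensmx_cons mulrA.
Qed.

End Kronecker.

(** * Tensor powers of a structure matrix *)

Lemma prod_lower (R : comNzRingType) k (phi : 'I_(k * 2) -> R) :
  \prod_p phi p = \prod_(a < k) (phi (lower1 a) * phi (lower2 a)).
Proof.
rewrite (reindex (@mxtens_index k 2)) /=; last first.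
  by exists (@mxtens_unindex k 2) => ? _;
    rewrite ?mxtens_indexK ?mxtens_unindexK.
rewrite (eq_bigr (fun p => phi (mxtens_index (p.1, p.2)))); last by case.
rewrite -(pair_bigA _ (fun a b => phi (mxtens_index (a, b)))) /=.
apply: eq_bigr => a _; rewrite !big_ord_recl big_ord0 mulr1.
by congr (_ * phi (mxtens_index (a, _))); apply: val_inj.
Qed.

(** The values of the lower indices, regrouped as one column number of [X] for
each factor of the tensor power. *)
Definition lower_pairs m k (l : {ffun 'I_(k * 2) -> 'I_m}) :
    {ffun 'I_k -> 'I_(m * m)} :=
  [ffun a => mxtens_index (l (lower1 a), l (lower2 a))].

Lemma lower_pairs_bij m k : bijective (@lower_pairs m k).
Proof.
apply: inj_card_bij; last by rewrite !card_ffun !card_ord mulnn -expnM mulnC.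
move=> l l' /ffunP ll'; apply/ffunP => p; case: (mxtens_indexP p) => a b.
have := ll' a; rewrite !ffunE => /(can_inj (@mxtens_indexK m m)) [l1 l2].
case: b => [[|[|//]] hb].
  by rewrite (_ : Ordinal hb = ord0) //; apply: val_inj.
by rewrite (_ : Ordinal hb = ord_max) //; apply: val_inj.
Qed.

Section Contraction.

Variables (R : comNzRingType) (m k : nat).
Implicit Types (X : 'M[R]_(m, m * m)) (l : {ffun 'I_(k * 2) -> 'I_m}).

(** The entry of [X^(x)k] with upper indices [u] and lower indices [l]. *)
Definition tensor_entry X (u : 'I_k -> 'I_m) l : R :=
  \prod_(a < k) X (u a) (mxtens_index (l (lower1 a), l (lower2 a))).

Lemma tensor_entry_mull (g : 'M[R]_m) X u l :
  tensor_entry (g *m X) u l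
  = \sum_(v : {ffun 'I_k -> 'I_m})
      (\prod_(a < k) g (u a) (v a)) * tensor_entry X v l.
Proof.
rewrite /tensor_entry; under eq_bigr => a _ do rewrite mxE.
by rewrite bigA_distr_bigA; apply: eq_bigr => v _; rewrite big_split.
Qed.

Lemma tensor_entry_mulr (h : 'M[R]_m) X u l :
  tensor_entry (X *m (h *t h)) u l
  = \sum_(l' : {ffun 'I_(k * 2) -> 'I_m})
      tensor_entry X u l' * \prod_p h (l' p) (l p).
Proof.
rewrite /tensor_entry; under eq_bigr => a _ do rewrite mxE.
rewrite bigA_distr_bigA (reindex (@lower_pairs m k)); last first.
  exact/onW_bij/lower_pairs_bij.
apply: eq_bigr => l' _; rewrite prod_lower -big_split; apply: eq_bigr => a _.
by rewrite ffunE tensmxE.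
Qed.

(** * Equivariance of contractions *)

Variable s : 'I_k -> 'I_(k * 2).
Hypothesis s_inj : injective s.

Lemma size_free_lower : size (enum [predC codom s]) == k.
Proof.
rewrite -cardE -(eqn_add2l #|codom s|) cardC card_codom // !card_ord.
by rewrite addnn muln2.
Qed.

Definition free_lower : k.-tuple 'I_(k * 2) := Tuple size_free_lower.

Definition free_word l : k.-tuple 'I_m := map_tuple l free_lower.

(** Injectivity of [s] is what makes the lower indices split evenly into [k]
contracted and [k] free ones; products over all of them then split too. *)
Definition position (x : 'I_k + 'I_k) : 'I_(k * 2) :=
  match x with inl a => s a | inr b => tnth free_lower b end.

Lemma position_bij : bijective position.
Proof.
have free_uniq : uniq free_lower by rewrite enum_uniq.
have notin_free a b : s a != tnth free_lower b.
  apply/eqP => sab; have := mem_tnth b free_lower.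
  by rewrite mem_enum inE -sab codom_f.
apply: inj_card_bij; last by rewrite card_sum !card_ord addnn muln2.
move=> [a|b] [a'|b'] /= e.
- by rewrite (s_inj e).
- by have := notin_free a b'; rewrite e eqxx.
- by have := notin_free a' b; rewrite e eqxx.
- by congr inr; apply: (elimT (tuple_uniqP _) free_uniq).
Qed.

Lemma prod_position (phi : 'I_(k * 2) -> R) :
  \prod_p phi p = (\prod_a phi (s a)) * \prod_b phi (tnth free_lower b).
Proof.
rewrite (reindex position); last exact/onW_bij/position_bij.
by rewrite big_sumType.
Qed.

(** The free indices are pinned to [w] and the contracted ones vary
independently. To apply distributivity to all the lower indices at once, the
pinning is written as a factor [0] or [1] at each free index. *)
Lemma sum_free_word w (psi : 'I_k -> 'I_m -> R) :
  \sum_(l : {ffun 'I_(k * 2) -> 'I_m} | free_word l == w)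
      \prod_a psi a (l (s a))
  = \prod_a \sum_i psi a i.
Proof.
have [d dK _] := position_bij.
pose phi p i :=
  match d p with inl a => psi a i | inr b => (i == tnth w b)%:R end.
have phis a i : phi (s a) i = psi a i.
  by rewrite /phi -[s a]/(position (inl a)) dK.
have phif b i : phi (tnth free_lower b) i = (i == tnth w b)%:R.
  by rewrite /phi -[tnth _ _]/(position (inr b)) dK.
transitivity (\prod_p \sum_i phi p i); last first.
  rewrite prod_position [X in _ * X]big1 ?mulr1 => [|b _].
    by apply: eq_bigr => a _; apply: eq_bigr => i _; rewrite phis.
  rewrite (bigD1 (tnth w b)) //= phif eqxx big1 ?addr0 // => i /negPf iw.
  by rewrite phif iw.
rewrite bigA_distr_bigA [RHS](bigID (fun l => free_word l == w)) /=.
rewrite [X in _ + X]big1 ?addr0 => [|l lw].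
  apply: eq_bigr => l /eqP lw; rewrite prod_position [X in _ * X]big1 ?mulr1.
    by apply: eq_bigr => a _; rewrite phis.
  by move=> b _; rewrite phif -lw tnth_map eqxx.
have [b lb] : exists b, l (tnth free_lower b) != tnth w b.
  apply/existsP; apply: contraNT lw; rewrite negb_exists => /forallP lw.
  by apply/eqP/eq_from_tnth => b; rewrite tnth_map; apply/eqP/negPn.
by rewrite prod_position [X in _ * X](bigD1 b) //= phif (negPf lb) mul0r mulr0.
Qed.

Lemma contractionE X w :
  contraction s X 0 (word_index w)
  = \sum_(l : {ffun 'I_(k * 2) -> 'I_m} | free_word l == w)
      tensor_entry X (fun a => l (s a)) l.
Proof.
rewrite mxE; apply: eq_bigl => l.
rewrite -(inj_eq (bij_inj (word_index_bij m k))) -val_eqE /= -map_comp.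
reflexivity.
Qed.

(** Expanding both matrix products leaves, for lower indices [l'] and upper
indices [v] of [X], the sum over [l] of
[prod_a h (l' (s a)) (l (s a)) * g (l (s a)) (v a)], which is
[prod_a (h g) (l' (s a)) (v a)] and so forces [v = l' o s]: this is the
contraction of [X]. The factors [h] at the free indices make up [h ^t k]. *)
Lemma contraction_equivariant (g h : 'M[R]_m) X : h *m g = 1%:M ->
  contraction s (g *m X *m (h *t h)) = contraction s X *m h ^t k.
Proof.
move=> hg; have [d idxK idxK'] := word_index_bij m k.
apply/rowP => q; rewrite -[q]idxK'; move: (d q) => w {q}.
rewrite [RHS]mxE (reindex (@word_index m k)) /=; last first.
  exact/onW_bij/word_index_bij.
rewrite contractionE.
transitivity (\sum_(l' : {ffun 'I_(k * 2) -> 'I_m})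
   \sum_(v : {ffun 'I_k -> 'I_m})
   tensor_entry X v l' * \prod_b h (tnth (free_word l') b) (tnth w b) *
   \sum_(l : {ffun 'I_(k * 2) -> 'I_m} | free_word l == w)
     \prod_a (h (l' (s a)) (l (s a)) * g (l (s a)) (v a))).
  under eq_bigr => l _ do rewrite tensor_entry_mulr.
  rewrite exchange_big; apply: eq_bigr => l' _ /=.
  under eq_bigr => l _ do rewrite tensor_entry_mull mulr_suml.
  rewrite exchange_big; apply: eq_bigr => v _ /=.
  rewrite mulr_sumr; apply: eq_bigr => l /eqP <-.
  rewrite prod_position big_split /=.
  under [in RHS]eq_bigr => b _ do rewrite !tnth_map.
  by rewrite mulrACA mulrC [X in _ * X]mulrC.
transitivity (\sum_(l' : {ffun 'I_(k * 2) -> 'I_m})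
   tensor_entry X (fun a => l' (s a)) l' *
   (h ^t k) (word_index (free_word l')) (word_index w)).
  apply: eq_bigr => l' _; rewrite ntensmxE.
  have deltaE (v : {ffun 'I_k -> 'I_m}) :
      \sum_(l : {ffun 'I_(k * 2) -> 'I_m} | free_word l == w)
      \prod_a (h (l' (s a)) (l (s a)) * g (l (s a)) (v a))
      = \prod_a (l' (s a) == v a)%:R.
    rewrite (sum_free_word w (fun a i => h (l' (s a)) i * g i (v a))).
    apply: eq_bigr => a _.
    by move/matrixP/(_ (l' (s a)) (v a)): hg; rewrite !mxE.
  rewrite (eq_bigr _ (fun v _ => congr1 (GRing.mul _) (deltaE v))).
  rewrite (bigD1 [ffun a => l' (s a)]) //= [X in _ + X]big1 ?addr0 => [|v vl'].
    rewrite [X in _ * X]big1 ?mulr1 => [|a _]; last by rewrite ffunE eqxx.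
    by congr (_ * _); apply: eq_bigr => a _; rewrite ffunE.
  have [a va] : exists a, l' (s a) != v a.
    apply/existsP; apply: contraNT vl'; rewrite negb_exists => /forallP vl'.
    by apply/eqP/ffunP => a; rewrite ffunE; apply/esym/eqP/negPn.
  by rewrite [X in _ * X](bigD1 a) //= (negPf va) mul0r mulr0.
rewrite (partition_big free_word xpredT) //=; apply: eq_bigr => w' _.
by rewrite contractionE mulr_suml; apply: eq_bigr => l' /eqP <-.
Qed.

End Contraction.

(** * The action of the general linear group *)

Definition tau (F : fieldType) m (g : 'M[F]_m) (A : 'M[F]_(m, m * m)) :=
  g *m A *m (invmx g *t invmx g).

Lemma invmx_mul (F : fieldType) n (A B : 'M[F]_n) :
  A \in unitmx -> B \in unitmx -> invmx (A *m B) = invmx B *m invmx A.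
Proof.
move=> uA uB; have uAB : A *m B \in unitmx by rewrite unitmx_mul uA.
apply: (can_inj (mulKmx uAB)).
by rewrite mulmxV // mulmxA mulmxK // mulmxV.
Qed.

Lemma tau_tau (F : fieldType) m (g h : 'M[F]_m) A :
  g \in unitmx -> h \in unitmx -> tau g (tau h A) = tau (g *m h) A.
Proof.
by move=> ug uh; rewrite /tau !mulmxA -mulmxA tensmx_mul invmx_mul.
Qed.

Lemma tau1 (F : fieldType) m (A : 'M[F]_(m, m * m)) : tau 1%:M A = A.
Proof. by rewrite /tau invmx1 tensmx11 mul1mx mulmx1. Qed.

(** As for contractions of higher tensor powers: [h a j * g j c] summed
over the contracted index [j] is [1%:M a c]. *)
Lemma Tr1_equivariant (R : comNzRingType) m (g h : 'M[R]_m)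
    (X : 'M[R]_(m, m * m)) :
  h *m g = 1%:M -> Tr1 (g *m X *m (h *t h)) = Tr1 X *m h.
Proof.
move=> hg; apply/rowP => i; rewrite !mxE.
transitivity (\sum_b \sum_a \sum_c
    (h *m g) a c * X c (mxtens_index (a, b)) * h b i).
  transitivity (\sum_j \sum_b \sum_a \sum_c
      g j c * X c (mxtens_index (a, b)) * (h a j * h b i)).
    apply: eq_bigr => j _.
    rewrite mxE (reindex (@mxtens_index m m)) /=; last first.
      by exists (@mxtens_unindex m m) => ? _;
        rewrite ?mxtens_indexK ?mxtens_unindexK.
    rewrite exchange_big pair_bigA; apply: eq_bigr => -[a b] _ /=.
    by rewrite tensmxE mxE mulr_suml.
  rewrite exchange_big; apply: eq_bigr => b _.
  rewrite exchange_big; apply: eq_bigr => a _.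
  rewrite exchange_big; apply: eq_bigr => c _.
  rewrite mxE !mulr_suml; apply: eq_bigr => j _.
  by rewrite mulrA; congr (_ * _); rewrite mulrC mulrA.
apply: eq_bigr => b _; rewrite mxE mulr_suml; apply: eq_bigr => a _.
rewrite hg (bigD1 a) //= mxE eqxx mul1r big1 ?addr0 // => c ca.
by rewrite mxE eq_sym (negPf ca) !mul0r.
Qed.

Lemma castmx_mulmx3 (R : pzRingType) m m' n n' (er : m = m') (ec : n = n')
    (G : 'M[R]_m) (N : 'M_(m, n)) (H : 'M_n) :
  castmx (er, ec) (G *m N *m H)
  = castmx (er, er) G *m castmx (er, ec) N *m castmx (ec, ec) H.
Proof. by case: m' / er; case: n' / ec; rewrite !castmx_id. Qed.

(** Used with [d = 1 ^ (k - 2)], the number of rows of a Kronecker power of the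
row vector [Tr1 X]. *)
Lemma castmx_tens1 (R : pzRingType) m d (e : (m * d = m)%N) (g : 'M[R]_m) :
  d = 1%N -> castmx (e, e) (g *t (1%:M : 'M_d)) = g.
Proof.
move=> d1; subst d; apply/matrixP => i j; rewrite castmxE /=.
have castE x : cast_ord (esym e) x = mxtens_index (x, ord0 : 'I_1).
  by apply: val_inj; rewrite /= muln1 addn0.
by rewrite !castE tensmxE mxE eqxx mulr1.
Qed.

Lemma colsub_mulmx (R : pzRingType) m n p q (f : 'I_q -> 'I_p)
    (A : 'M[R]_(m, n)) (B : 'M_(n, p)) : colsub f (A *m B) = A *m colsub f B.
Proof.
by apply/matrixP => i j; rewrite !mxE; apply: eq_bigr => a _; rewrite !mxE.
Qed.

Section Equivariance.

Variables (F : fieldType) (m k : nat) (hk : (2 <= k)%N).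
Variables (c : 'I_(m ^ k) -> 'I_k -> 'I_(k * 2)) (h : 'I_m -> 'I_(m ^ k)).
Hypothesis c_inj : forall r, injective (c r).

Lemma Qmx_tau (g : 'M[F]_m) A : g \in unitmx ->
  Qmx c (tau g A) = Qmx c A *m invmx g ^t k.
Proof.
move=> ug; apply/row_matrixP => r; rewrite row_mul !rowK.
by apply: contraction_equivariant; rewrite // mulVmx.
Qed.

(** The numerator and [Qmx] pick up the same factor [invmx g ^t k] on the right,
which cancels in their quotient. *)
Lemma Mmx_tau (g : 'M[F]_m) A : g \in unitmx -> \det (Qmx c A) != 0 ->
  Mmx hk c (tau g A) = g *m Mmx hk c A.
Proof.
move=> ug; rewrite -unitfE -unitmxE => uQ.
have [_ uH] : g ^t k \in unitmx /\ invmx g ^t k \in unitmx.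
  by apply: mulmx1_unit; rewrite ntensmx_mul mulmxV // ntensmx_id.
rewrite /Mmx Qmx_tau // invmx_mul // {1}/tau.
rewrite (_ : Tr1 (tau g A) = Tr1 A *m invmx g); last first.
  by apply: Tr1_equivariant; rewrite mulVmx.
rewrite -ntensmx_mul -tensmx_mul -[X in g *m A *t X]mul1mx -tensmx_mul.
have ek : k = (k - 2).+2 by rewrite -addn2 subnK.
rewrite castmx_mulmx3 castmx_tens1 ?exp1n // castmx_ntensmx //.
by rewrite !mulmxA mulmxK.
Qed.

Lemma Psub_tau (g : 'M[F]_m) A : g \in unitmx -> \det (Qmx c A) != 0 ->
  Psub hk c h (tau g A) = g *m Psub hk c h A.
Proof. by move=> ug uQ; rewrite /Psub Mmx_tau // colsub_mulmx. Qed.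

(** Along an orbit [Pmx (tau g A) = Pmx A *m invmx g], so both sides reduce to
[tau] being an action; in the other direction the element that carries [A] to
[B] is [invmx (Pmx B) *m Pmx A]. *)
Lemma same_orbit_iff_eq_canonical_form (A B : 'M[F]_(m, m * m)) :
  A \in V0 hk c h -> B \in V0 hk c h ->
  (exists2 g, g \in unitmx & B = tau g A) <->
  tau (Pmx hk c h A) A = tau (Pmx hk c h B) B.
Proof.
rewrite !inE => /andP[QA PA] /andP[QB PB]; rewrite /Pmx.
split=> [[g ug eB]|eAB].
  rewrite {2}eB {1}eB Psub_tau // tau_tau ?unitmx_inv ?unitmx_mul ?ug //.
  by rewrite invmx_mul // mulmxKV.
exists (Psub hk c h B *m invmx (Psub hk c h A)).
  by rewrite unitmx_mul PB unitmx_inv.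
by rewrite -tau_tau ?unitmx_inv // eAB tau_tau ?unitmx_inv // mulmxV // tau1.
Qed.

End Equivariance.

(** * Isomorphism of algebras *)

Section Isomorphism.

Variable F : fieldType.

Lemma lincomb_linear m (W : lmodType F) (e : m.-tuple W) : linear (lincomb e).
Proof.
move=> a u v; rewrite /lincomb scaler_sumr -big_split; apply: eq_bigr => i _.
by rewrite !mxE scalerDl scalerA.
Qed.

Definition coords m (W : vectType F) (e : m.-tuple W) (x : W) : 'cV[F]_m :=
  \col_i coord e i x.

Lemma coords_linear m (W : vectType F) (e : m.-tuple W) : linear (coords e).
Proof. by move=> a x y; apply/colP => i; rewrite !mxE linearP. Qed.

Lemma coordsK m (W : vectType F) (e : m.-tuple W) : basis_of fullv e ->
  cancel (coords e) (lincomb e).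
Proof.
move=> he x; rewrite {2}(coord_basis he (memvf x)) /lincomb.
by apply: eq_bigr => i _; rewrite mxE (tnth_nth 0).
Qed.

Lemma lincombK m (W : vectType F) (e : m.-tuple W) : basis_of fullv e ->
  cancel (lincomb e) (coords e).
Proof.
move=> he u; apply/colP => i; rewrite mxE /lincomb.
rewrite -[RHS](coord_sum_free (u^~ 0) i (basis_free he)).
by congr (coord e i _); apply: eq_bigr => j _; rewrite (tnth_nth 0).
Qed.

(** Pure tensors span: already products of unit vectors pick out each column. *)
Lemma eq_mulmx_tens m n p (A B : 'M[F]_(p, m * n)) :
  (forall (u : 'cV_m) (v : 'cV_n), A *m (u *t v) = B *m (u *t v)) -> A = B.
Proof.
move=> eqAB; apply/matrixP => i jl; case: (mxtens_indexP jl) => j l.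
have entryE (C : 'M[F]_(p, m * n)) :
    (C *m (delta_mx j (0 : 'I_1) *t delta_mx l (0 : 'I_1)))
      i (mxtens_index (0, 0))
    = C i (mxtens_index (j, l)).
  rewrite mxE (bigD1 (mxtens_index (j, l))) //=.
  rewrite tensmxE !mxE !eqxx !mulr1 big1 ?addr0 // => q.
  case: (mxtens_indexP q) => a b.
  rewrite (can_eq (@mxtens_indexK m n)) xpair_eqE.
  by rewrite tensmxE !mxE !andbT -natrM mulnb => /negPf ->; rewrite mulr0.
by rewrite -!entryE eqAB.
Qed.

Variables (m : nat) (W1 W2 : vectType F).
Variables (mul1 : W1 -> W1 -> W1) (mul2 : W2 -> W2 -> W2).
Variables (e1 : m.-tuple W1) (e2 : m.-tuple W2) (A B : 'M[F]_(m, m * m)).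
Hypotheses (he1 : basis_of fullv e1) (he2 : basis_of fullv e2).
Hypotheses (hA : structure_constants mul1 e1 A).
Hypotheses (hB : structure_constants mul2 e2 B).

(** In coordinates a linear bijection [f] is a matrix [g], and [f] is
multiplicative when [g A (u (x) v) = B (g u (x) g v)] for all [u] and [v], that
is, when [g A = B (g (x) g)]. *)
Lemma algebra_isomorphic_iff_same_orbit :
  algebra_isomorphic mul1 mul2 <-> exists2 g, g \in unitmx & B = tau g A.
Proof.
split=> [[f [[f' fK f'K] fM]]|[g ug eB]].
  pose g : 'M[F]_m := \matrix_(i, j) coord e2 i (f (tnth e1 j)).
  have fE u : f (lincomb e1 u) = lincomb e2 (g *m u).
    apply: (can_inj (coordsK he2)); rewrite lincombK //; apply/colP => i.
    rewrite !mxE /lincomb !linear_sum; apply: eq_bigr => j _.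
    by rewrite !linearZ mxE mulrC.
  pose g' : 'M[F]_m := \matrix_(i, j) coord e1 i (f' (tnth e2 j)).
  have gg' : g *m g' = 1%:M.
    apply/matrixP => i j; have := congr1 (fun u : 'cV_m => u i 0)
        (lincombK he2 (g *m coords e1 (f' (tnth e2 j)))).
    rewrite -fE coordsK // f'K !mxE (tnth_nth 0).
    rewrite coord_free ?(basis_free he2) //.
    by rewrite eq_sym => ->; apply: eq_bigr => a _; rewrite !mxE !(tnth_nth 0).
  have [ug _] := mulmx1_unit gg'; exists g => //.
  have gA : g *m A = B *m (g *t g).
    apply: eq_mulmx_tens => u v; apply: (can_inj (lincombK he2)).
    by rewrite -!mulmxA -fE -hA fM !fE hB tensmx_mul.
  by rewrite /tau gA -mulmxA tensmx_mul mulmxV // tensmx11 mulmx1.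
have fl : linear (fun x => lincomb e2 (g *m coords e1 x)).
  by move=> a x y; rewrite coords_linear mulmxDr -scalemxAr lincomb_linear.
pose fL : {linear W1 -> W2} := HB.pack (fun x => lincomb e2 (g *m coords e1 x))
  (GRing.isLinear.Build _ _ _ _ _ fl).
exists fL; split=> /=.
  exists (fun y => lincomb e1 (invmx g *m coords e2 y)) => x /=.
    by rewrite lincombK // mulKmx // coordsK.
  by rewrite lincombK // mulKVmx // coordsK.
move=> x y; rewrite -{1}(coordsK he1 x) -{1}(coordsK he1 y).
rewrite hA lincombK // hB eB.
by rewrite /tau -!mulmxA tensmx_mul !mulKmx.
Qed.

End Isomorphism.

Theorem theorem3p1 (F : closedFieldType) (m : nat) (hm : (1 <= m)%N)
    (k : nat) (hk : (2 <= k)%N)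
    (c : 'I_(m ^ k) -> 'I_k -> 'I_(k * 2)) (h : 'I_m -> 'I_(m ^ k))
    (hadm : admissible F hk c h)
    (W1 W2 : vectType F)
    (mul1 : {bilinear W1 -> W1 -> W1}) (mul2 : {bilinear W2 -> W2 -> W2})
    (e1 : m.-tuple W1) (e2 : m.-tuple W2)
    (he1 : basis_of fullv e1) (he2 : basis_of fullv e2)
    (A B : 'M[F]_(m, m * m))
    (hA : structure_constants mul1 e1 A) (hB : structure_constants mul2 e2 B)
    (hA0 : A \in V0 hk c h) (hB0 : B \in V0 hk c h) :
  algebra_isomorphic mul1 mul2 <->
  Pmx hk c h A *m A *m (invmx (Pmx hk c h A) *t invmx (Pmx hk c h A)) =
  Pmx hk c h B *m B *m (invmx (Pmx hk c h B) *t invmx (Pmx hk c h B)).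
Proof.
have [c_inj _ _] := hadm.
apply: iff_trans (algebra_isomorphic_iff_same_orbit he1 he2 hA hB) _.
exact: same_orbit_iff_eq_canonical_form.
Qed.
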